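(* The patterns $1324$ and $1423$ are strong-c-forest-Wilf equivalent, and therefore c-forest-Wilf equivalent.
   Context: A forest on $[n]$ is an unordered rooted forest with $n$ vertices labeled bijectively by $1,\dots,n$; $F_n$ is the set of such forests. A consecutive instance of $\sigma\in\mathcal{S}_k$ in a labeled forest is a sequence of vertices $v_1,\dots,v_k$ with $v_i$ the parent of $v_{i+1}$ for $1\le i\le k-1$ and the labels of $v_1,\dots,v_k$ in the same relative order as $\sigma(1),\dots,\sigma(k)$; a forest avoids $\sigma$ (as a consecutive pattern) if it has no consecutive instance of $\sigma$. Patterns $\sigma,\tau$ are strong-c-forest-Wilf equivalent if for all $n,m\ge 0$ the number of forests in $F_n$ with exactly $m$ consecutive instances of $\sigma$ equals the number with exactly $m$ consecutive instances of $\tau$; they are c-forest-Wilf equivalent if for all $n$ the number of forests in $F_n$ avoiding $\sigma$ equals the number avoiding $\tau$. *)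

(* Defs.v *)
From mathcomp Require Import all_boot all_fingroup.

Set Implicit Arguments.
Unset Strict Implicit.
Unset Printing Implicit Defensive.

(* A forest on [n] is encoded by its parent function f : the vertex labeled
   i.+1 is represented by i : 'I_n, f v = Some u means that u is the parent of
   v, and f v = None that v is a root.  *)
Definition is_parent n (f : {ffun 'I_n -> option 'I_n}) : rel 'I_n :=
  fun u v => f v == Some u.

(* Since each vertex has at most one parent, being a rooted forest amounts to
   the absence of directed cycles: no v is an ancestor of (or equal to) its own
   parent. *)
Definition is_forest n (f : {ffun 'I_n -> option 'I_n}) : bool :=
  [forall u, forall v, is_parent f u v ==> ~~ connect (is_parent f) v u].

Definition forests n : {set {ffun 'I_n -> option 'I_n}} :=
  [set f | is_forest f].

Definition consecutive_instance n k (f : {ffun 'I_n -> option 'I_n})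
    (sigma : 'S_k) (v : k.-tuple 'I_n) : bool :=
  [forall i : 'I_k, forall j : 'I_k,
     (j == i.+1 :> nat) ==> is_parent f (tnth v i) (tnth v j)]
  && [forall i : 'I_k, forall j : 'I_k,
     (tnth v i < tnth v j) == (sigma i < sigma j)].

Definition num_instances n k (f : {ffun 'I_n -> option 'I_n})
    (sigma : 'S_k) : nat :=
  #|[set v : k.-tuple 'I_n | consecutive_instance f sigma v]|.

Definition avoids n k (f : {ffun 'I_n -> option 'I_n}) (sigma : 'S_k) : bool :=
  ~~ [exists v : k.-tuple 'I_n, consecutive_instance f sigma v].

Definition strong_c_forest_Wilf_equivalent k l
    (sigma : 'S_k) (tau : 'S_l) : Prop :=
  forall n m : nat,
    #|[set f in forests n | num_instances f sigma == m]| =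
    #|[set f in forests n | num_instances f tau == m]|.

Definition c_forest_Wilf_equivalent k l (sigma : 'S_k) (tau : 'S_l) : Prop :=
  forall n : nat,
    #|[set f in forests n | avoids f sigma]| =
    #|[set f in forests n | avoids f tau]|.

Section OneLine.
Variables (k : nat) (w : k.-tuple nat) (w_perm : perm_eq w (iota 1 k)).

Lemma one_line_bound (i : 'I_k) : 0 < tnth w i <= k.
Proof.
by have := mem_tnth i w; rewrite (perm_mem w_perm) mem_iota add1n ltnS.
Qed.

Lemma one_line_lt (i : 'I_k) : (tnth w i).-1 < k.
Proof. by have /andP[w_gt0 le_wk] := one_line_bound i; rewrite prednK. Qed.

Lemma one_line_inj : injective (fun i => Ordinal (one_line_lt i)).
Proof.
move=> i j /(congr1 val)/= /(congr1 S).
rewrite !prednK; last 2 first.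
- by case/andP: (one_line_bound j).
- by case/andP: (one_line_bound i).
have /tuple_uniqP inj_w : uniq w by rewrite (perm_uniq w_perm) iota_uniq.
exact: inj_w.
Qed.

(* The permutation with one-line notation w(1) ... w(k), see one_lineE for the
   shift between {1, ..., k} and 'I_k. *)
Definition one_line : 'S_k := perm one_line_inj.

Lemma one_lineE (i : 'I_k) : (one_line i).+1 = tnth w i.
Proof.
by rewrite permE /= prednK //; case/andP: (one_line_bound i).
Qed.

End OneLine.

Definition pattern1324 : 'S_4 :=
  @one_line 4 [tuple of [:: 1; 3; 2; 4]] isT.

Definition pattern1423 : 'S_4 :=
  @one_line 4 [tuple of [:: 1; 4; 2; 3]] isT.

(* Main.v *)
(* Call a vertex c active when its parent b and grandparent a satisfy a < c < b.
   The instances of 1324 (resp. 1423) with third vertex c correspond to the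
   children d of c with d > b (resp. c < d < b), so that the arcs (a, b) and
   (c, d) cross (resp. are nested).  As for crossings and nestings of set
   partitions, read the labels from right to left: each opener c picks its arc
   ends d, and its parent b if it is active, among the arc ends to its right not
   yet picked by larger openers, and reversing the order of these candidates
   exchanges crossings and nestings at c.  To keep the graph acyclic,
   the candidates are restricted to the block of c, made of the arcs whose
   openers have the same image as c under iteration of the grandparent map on
   active vertices.  Doing this for one vertex t at a time turns the number of
   crossings into the number of nestings. *)
Require Import Defs.
From mathcomp Require Import all_boot all_fingroup.
From mathcomp Require Import zify.

Set Implicit Arguments.
Unset Strict Implicit.
Unset Printing Implicit Defensive.

(** * Order-reversing involution on a set of labels *)

Section Flip.
Variable n : nat.
Implicit Types (P : {set 'I_n}) (x y : 'I_n).

(** Outside [P] the index is the length of [enum P], so the default value [x] of [nth] makes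
    [flip P] the identity there. *)
Definition flip P x := nth x (rev (enum P)) (index x (enum P)).

Lemma flip_notin P x : x \notin P -> flip P x = x.
Proof.
by move=> xNP; rewrite /flip nth_default // size_rev leqNgt index_mem mem_enum.
Qed.

Lemma flip_mem P x : (flip P x \in P) = (x \in P).
Proof.
have [xP|xNP] := boolP (x \in P); last by rewrite flip_notin // (negPf xNP).
by rewrite -mem_enum -mem_rev mem_nth // size_rev index_mem mem_enum.
Qed.

Lemma index_flip P x : x \in P ->
  index (flip P x) (enum P) = size (enum P) - (index x (enum P)).+1.
Proof.
move=> xP; have lt_x : index x (enum P) < size (enum P).
  by rewrite index_mem mem_enum.
rewrite {1}/flip nth_rev // index_uniq ?enum_uniq //.
by move: lt_x; case: (size _) => [|m] // _; rewrite ltnS subSS leq_subr.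
Qed.

Lemma flipK P : involutive (flip P).
Proof.
move=> x; have [xP|xNP] := boolP (x \in P); last by rewrite !flip_notin.
have lt_x : index x (enum P) < size (enum P) by rewrite index_mem mem_enum.
have lt_fx : index (flip P x) (enum P) < size (enum P).
  by rewrite index_mem mem_enum flip_mem.
rewrite {1}/flip nth_rev // index_flip // -subSn // subSS subKn; last exact: ltnW.
by rewrite (set_nth_default x) ?nth_index ?mem_enum.
Qed.

Lemma ltn_enum_index P : {in P &, forall x y,
  (index x (enum P) < index y (enum P)) = (x < y)}.
Proof.
have enum_lt : sorted (fun x y : 'I_n => x < y) (enum P).
  rewrite /enum_mem -enumT; apply: sorted_filter.
    by move=> y x z; apply: ltn_trans.
  by have := iota_ltn_sorted 0 n; rewrite -val_enum_ord sorted_map.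
have lt_index : {in P &, forall x y,
    index x (enum P) < index y (enum P) -> x < y}.
  move=> x y xP yP lt_xy.
  have lt_tr : transitive (fun x y : 'I_n => x < y).
    by move=> ? ? ?; apply: ltn_trans.
  have := sorted_ltn_nth lt_tr x enum_lt; move/(_ (index x (enum P))).
  move/(_ (index y (enum P))); rewrite !inE !index_mem !mem_enum xP yP.
  by rewrite !nth_index ?mem_enum //; apply.
move=> x y xP yP; apply/idP/idP; first exact: lt_index.
move=> lt_xy; rewrite ltnNge; apply/negP; rewrite leq_eqVlt => /orP[/eqP eq_yx|].
  have := congr1 (nth x (enum P)) eq_yx.
  by rewrite !nth_index ?mem_enum // => eq_y; rewrite eq_y ltnn in lt_xy.
by move/(lt_index y x yP xP); lia.
Qed.

Lemma ltn_flip P : {in P &, forall x y, (flip P x < flip P y) = (y < x)}.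
Proof.
move=> x y xP yP; rewrite -!(@ltn_enum_index P) ?flip_mem // !index_flip //.
by rewrite ltn_sub2lE // index_mem mem_enum.
Qed.

End Flip.

(** * Active vertices, blocks, and relabelling across a cut *)

Section Exchange.
Variable n : nat.
Implicit Types (f : {ffun 'I_n -> option 'I_n}) (P : {set 'I_n}).
Implicit Types (r x y v : 'I_n) (s : nat).

Definition hop f x :=
  if f x is Some b then
    if f b is Some a then if a < x < b then a else x else x
  else x.

Definition active f x := hop f x != x.

Lemma activeP f x :
  reflect (exists b a, [/\ f x = Some b, f b = Some a, a < x, x < b
                         & hop f x = a])
          (active f x).
Proof.
rewrite /active; apply: (iffP idP) => [|[b [a [_ _ lt_ax _ ->]]]]; last first.
  by apply/eqP=> eq_ax; rewrite eq_ax ltnn in lt_ax.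
rewrite /hop; case fx: (f x) => [b|]; last by rewrite eqxx.
case fb: (f b) => [a|]; last by rewrite eqxx.
case: ifP => [/andP[lt_ax lt_xb] _|]; last by rewrite eqxx.
by exists b, a.
Qed.

Lemma active_intro f x b a :
  f x = Some b -> f b = Some a -> a < x -> x < b -> active f x.
Proof.
move=> fx fb lt_ax lt_xb; apply/activeP; exists b, a; split=> //.
by rewrite /hop fx fb lt_ax lt_xb.
Qed.

Definition block_root f x := iter n (hop f) x.

(* An active vertex decreases under hop, so n iterations reach a fixed point. *)
Lemma hop_block_root f x : hop f (block_root f x) = block_root f x.
Proof.
have iter_hop k : hop f (iter k (hop f) x) = iter k (hop f) x
    \/ iter k.+1 (hop f) x + k < x.
  elim: k => [|k IHk].
    have [|/negbNE/eqP ->] := boolP (active f x); last by left.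
    by case/activeP => b [a [_ _ lt_ax _ /= ->]]; right; rewrite addn0.
  case: IHk => [eq_k|lt_k]; first by left; rewrite !iterS !eq_k.
  rewrite !iterS in lt_k *; set z := hop f _ in lt_k *.
  have [|/negbNE/eqP eq_z] := boolP (active f z); last by left.
  by case/activeP => b [a [_ _ lt_az _ ->]]; right; lia.
by case: (iter_hop n) => // ; have := ltn_ord x; lia.
Qed.

Lemma block_root_hop f x : block_root f (hop f x) = block_root f x.
Proof. by rewrite /block_root -iterSr iterS hop_block_root. Qed.

Lemma block_root_inactive f x : ~~ active f x -> block_root f x = x.
Proof. by move/negbNE/eqP=> fix_x; rewrite /block_root iter_fix. Qed.

(** When [straddle f s P] holds, the edges with an endpoint below [s] are relabelled by [flip P] and
    all other edges stay: the graph is cut at [s] and glued again along [P]. *)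
Definition exchange f s P : {ffun 'I_n -> option 'I_n} :=
  [ffun v : 'I_n => if s <= v then f (flip P v) else omap (flip P) (f v)].

Definition straddle f s P :=
  {in P, forall y, s <= y /\ exists2 x, f y = Some x & x < s}.

Lemma straddle_flip_lt f s P x : straddle f s P -> x < s -> flip P x = x.
Proof.
move=> fP lt_xs; apply: flip_notin; apply/negP=> /fP[]; lia.
Qed.

Lemma straddle_leq_flip f s P x :
  straddle f s P -> (s <= flip P x) = (s <= x).
Proof.
move=> fP; have [xP|xNP] := boolP (x \in P); last by rewrite flip_notin.
have [-> _] := fP x xP; have [|-> //] := fP (flip P x).
by rewrite flip_mem.
Qed.

Lemma exchangeK f s P : straddle f s P -> exchange (exchange f s P) s P = f.
Proof.
move=> fP; apply/ffunP=> v; rewrite !ffunE.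
rewrite (straddle_leq_flip _ fP) flipK; case: (s <= v) => //.
by case: (f v) => //= u; rewrite flipK.
Qed.

Lemma straddle_exchange f s P : straddle f s P -> straddle (exchange f s P) s P.
Proof.
move=> fP y yP; have [le_sy _] := fP y yP; split=> //.
by rewrite ffunE le_sy; case: (fP (flip P y)); rewrite ?flip_mem.
Qed.

Lemma straddle_notin f s P x u :
  straddle f s P -> f x = Some u -> s <= u -> x \notin P.
Proof.
move=> fP fx le_su; apply/negP=> /fP[_ [u']]; rewrite fx => -[<-].
by rewrite ltnNge le_su.
Qed.

Lemma exchange_above f s P x b :
  straddle f s P -> f x = Some b -> s <= x -> x < b -> exchange f s P x = Some b.
Proof.
move=> fP fx le_sx lt_xb; rewrite ffunE le_sx flip_notin //.
exact: (straddle_notin fP fx (leq_trans le_sx (ltnW lt_xb))).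
Qed.

Lemma exchange_below f s P x b :
  straddle f s P -> f x = Some b -> x < s ->
  exchange f s P x = Some (flip P b).
Proof. by move=> fP fx lt_xs; rewrite ffunE leqNgt lt_xs fx. Qed.

Lemma exchange_flip f s P y a :
  straddle f s P -> f y = Some a -> a < s -> exchange f s P (flip P y) = Some a.
Proof.
move=> fP fy lt_as; rewrite ffunE (straddle_leq_flip _ fP) flipK.
have [//|lt_ys] := leqP s y.
by rewrite (straddle_flip_lt fP lt_ys) fy /= (straddle_flip_lt fP lt_as).
Qed.

(** If [x < s], the grandparent is kept and the flipped parent stays on its side of [s]. If
    [s <= x], the parent [b] is kept; it keeps its own parent too, unless it lies in [P], and then
    its new parent is below [s], hence below [x]. *)
Lemma active_exchange_imply f s P x :
  straddle f s P -> active f x -> active (exchange f s P) x.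
Proof.
move=> fP /activeP[b [a [fx fb lt_ax lt_xb _]]].
have [le_sx|lt_xs] := leqP s x.
  have gx := exchange_above fP fx le_sx lt_xb.
  have [bP|bNP] := boolP (b \in P); last first.
    apply: (active_intro gx _ lt_ax lt_xb).
    by rewrite ffunE (leq_trans le_sx (ltnW lt_xb)) flip_notin.
  have [_ [a' gb lt_a's]] := straddle_exchange fP bP.
  exact: (active_intro gx gb (leq_trans lt_a's le_sx) lt_xb).
have gx := exchange_below fP fx lt_xs.
have gb := exchange_flip fP fb (ltn_trans lt_ax lt_xs).
apply: (active_intro gx gb lt_ax).
have [le_sb|lt_bs] := leqP s b; last by rewrite (straddle_flip_lt fP).
by apply: leq_trans lt_xs _; rewrite (straddle_leq_flip _ fP).
Qed.

Lemma active_exchange f s P : straddle f s P ->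
  active (exchange f s P) =1 active f.
Proof.
move=> fP x; apply/idP/idP; last exact: active_exchange_imply.
rewrite -{2}(exchangeK fP); apply: active_exchange_imply.
exact: straddle_exchange.
Qed.

(** * Reversal of the pending arc ends of one block *)

Definition pending f s r : {set 'I_n} :=
  [set y : 'I_n | (s <= y) && oapp (fun x : 'I_n => (x < s) && (block_root f x == r))
                            false (f y)].

Lemma pendingP f s r y :
  reflect (exists x, [/\ f y = Some x, x < s, s <= y & block_root f x = r])
          (y \in pending f s r).
Proof.
rewrite inE; apply: (iffP andP) => [[le_sy]|[x [-> lt_xs -> <-]]]; last first.
  by rewrite /= lt_xs eqxx.
by case: (f y) => //= x /andP[lt_xs /eqP <-]; exists x.
Qed.

Lemma straddle_pending f s r : straddle f s (pending f s r).
Proof. by move=> y /pendingP[x [fy lt_xs le_sy _]]; split=> //; exists x. Qed.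

Definition swap f s r := exchange f s (pending f s r).

Lemma active_swap f s r : active (swap f s r) =1 active f.
Proof. exact: active_exchange (@straddle_pending f s r). Qed.

(** Induction on the label, since [hop] decreases active vertices. The grandparent of an active
    vertex either stays the same or is replaced by another opener with block root [r]. *)
Lemma block_root_swap f s r : block_root (swap f s r) =1 block_root f.
Proof.
move=> x; have [k] := ubnP (x : nat); elim: k x => // k IHk x lt_xk.
have fP := @straddle_pending f s r.
have [act_x|inact_x] := boolP (active f x); last first.
  by rewrite !block_root_inactive ?active_swap.
have /activeP[b [a [fx fb lt_ax lt_xb hop_x]]] := act_x.
have := act_x; rewrite -(active_swap _ s r) => /activeP[b' [a' []]].
move=> gx gb lt_a'x _ hop'_x.
rewrite -block_root_hop hop'_x -[RHS]block_root_hop hop_x.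
rewrite IHk; last by lia.
have [le_sx|lt_xs] := leqP s x.
  move: gx; rewrite /swap (exchange_above fP fx) // => -[eq_b].
  move: gb; rewrite -eq_b ffunE (leq_trans le_sx (ltnW lt_xb)).
  have [bP|bNP] := boolP (b \in pending f s r); last first.
    by rewrite flip_notin // fb => -[->].
  have /pendingP[x1 [-> _ _ root_x1]] : flip (pending f s r) b \in pending f s r.
    by rewrite flip_mem.
  have /pendingP[x2 [fx2 _ _ root_x2]] := bP; move: fx2; rewrite fb.
  by case=> -> [<-]; rewrite root_x1.
move: gx; rewrite /swap (exchange_below fP fx) // => -[eq_b].
move: gb; rewrite -eq_b (exchange_flip fP fb) => [[->] //|].
exact: ltn_trans lt_xs.
Qed.

Lemma pending_swap f s r : pending (swap f s r) s r = pending f s r.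
Proof.
have fP := @straddle_pending f s r.
apply/setP=> y; rewrite -[RHS]flip_mem [LHS]inE [RHS]inE.
rewrite (straddle_leq_flip _ fP); case le_sy: (s <= y) => //=.
rewrite /swap ffunE le_sy; case: (f _) => //= x.
by rewrite -/(swap f s r) block_root_swap.
Qed.

(** Block roots are invariant, so the second swap flips the same pending set. *)
Lemma swapK s r : involutive (fun f => swap f s r).
Proof.
move=> f; rewrite {1}/swap pending_swap; apply: exchangeK.
exact: straddle_pending.
Qed.

(** * Preservation of acyclicity *)

Lemma is_forestP f :
  reflect (exists h : 'I_n -> nat, forall v u, f v = Some u -> h u < h v)
          (is_forest f).
Proof.
apply: (iffP idP) => [/forallP forest_f|[h h_lt]].
  (* The height of [v] is its number of ancestors, itself included. *)
  exists (fun v => #|[set w | connect (is_parent f) w v]|) => v u fv.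
  have par_uv : is_parent f u v by rewrite /is_parent fv.
  apply: proper_card; apply/properP; split.
    by apply/subsetP=> w; rewrite !inE => /connect_trans; apply; apply: connect1.
  exists v; rewrite !inE ?connect0 //.
  by have /forallP/(_ v)/implyP/(_ par_uv) := forest_f u.
have h_connect v u : connect (is_parent f) v u -> h v <= h u.
  move=> /connectP[p path_p ->]; elim: p v path_p => //= w p IHp v.
  by case/andP=> /eqP/h_lt lt_vw /IHp; apply: leq_trans; apply: ltnW.
apply/forallP=> u; apply/forallP=> v; apply/implyP=> /eqP/h_lt lt_uv.
by apply/negP=> /h_connect; rewrite leqNgt lt_uv.
Qed.

(** The block of the edge from [v] to its parent. Its opener is [v] itself if [v] is active, and the
    parent if that is smaller; any other edge belongs to no block. *)
Definition block f v : option 'I_n :=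
  if active f v then Some (block_root f v)
  else if f v is Some x then if x < v then Some (block_root f x) else None
  else None.

Lemma block_active f v : active f v -> block f v = Some (block_root f v).
Proof. by rewrite /block => ->. Qed.

Lemma block_up f v x : f v = Some x -> x < v -> block f v = Some (block_root f x).
Proof.
move=> fv lt_xv; rewrite /block; case: ifP => [|_]; last by rewrite fv lt_xv.
case/activeP=> b [a [fv' _ _ lt_vb _]]; move: fv' lt_vb; rewrite fv => -[<-].
by rewrite ltnNge (ltnW lt_xv).
Qed.

Lemma block_pending f s r y : y \in pending f s r -> block f y = Some r.
Proof.
by case/pendingP=> x [fy lt_xs le_sy <-]; apply: block_up (leq_trans lt_xs le_sy).
Qed.

Lemma block_swap f s r : block (swap f s r) =1 block f.
Proof.
(* It suffices that values [Some q] persist: since the swap is an involution, the same claim for the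
   swapped graph excludes new ones. *)
have block_swap_imply g v q :
    block g v = Some q -> block (swap g s r) v = Some q.
  have [act_v|inact_v] := boolP (active g v).
    by rewrite !block_active ?active_swap ?block_root_swap.
  rewrite {1}/block (negPf inact_v); case gv: (g v) => [x|//].
  case: ifP => // lt_xv [<-].
  have gP := @straddle_pending g s r.
  have [lt_vs|le_sv] := ltnP v s.
    rewrite (@block_up _ _ x) ?block_root_swap //.
    rewrite /swap (exchange_below gP gv lt_vs) (straddle_flip_lt gP) //.
    exact: ltn_trans lt_vs.
  have [vP|vNP] := boolP (v \in pending g s r); last first.
    by rewrite (@block_up _ _ x) ?block_root_swap // /swap ffunE le_sv flip_notin.
  have := vP; rewrite -pending_swap => /block_pending ->.
  by rewrite -(block_pending vP) (block_up gv).
move=> v; case fv: (block f v) => [q|]; first exact: block_swap_imply.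
case gv: (block _ v) => [q|//].
by have := block_swap_imply _ _ _ gv; rewrite swapK fv.
Qed.

(* The rank is lexicographic: first the height in f, where a whole block is put just
   below its root; within a block, an edge goes from an active c to an arc
   (a, b) with a < c, and from b to a. *)
Lemma forest_swap f s r : is_forest f -> is_forest (swap f s r).
Proof.
case/is_forestP=> h h_lt; set g := swap f s r.
have fP := @straddle_pending f s r.
have h_hop x : h (hop f x) <= h x.
  have [|/negbNE/eqP -> //] := boolP (active f x).
  by case/activeP=> b [a [/h_lt lt_b /h_lt lt_a _ _ ->]]; lia.
have h_root x : h (block_root f x) <= h x.
  have h_iter k : h (iter k (hop f) x) <= h x.
    by elim: k => //= k; apply: leq_trans.
  exact: h_iter.
pose level v := if block f v is Some r then (h r).*2.+1 else (h v).*2.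
have level_le v : level v <= (h v).*2.+1.
  rewrite /level; case fv: (block f v) => [q|//]; move: fv; rewrite /block.
  case: ifP => [_ [<-]|_]; first by have := h_root v; lia.
  case fv: (f v) => [x|//]; case: ifP => // _ [<-].
  by have := h_root x; have := h_lt _ _ fv; lia.
(* Doubling makes room for an arc end with opener [a], at [2a+1], strictly between the active
   vertices [a], at [2a], and [c > a], at [2c]. *)
pose second v :=
  if g v is Some x then if x < v then x.*2.+1 else v.*2 else 0.
have second_lt v : second v < n.*2.
  rewrite /second; have lt_v := ltn_ord v; case: (g v) => [x|]; last by lia.
  by have lt_x := ltn_ord x; case: ifP => _; lia.
suff lex v u : g v = Some u ->
    level u < level v \/ level u = level v /\ second u < second v.
  apply/is_forestP; exists (fun v => level v * n.*2 + second v) => v u gv.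
  case: (lex v u gv) => [lt_uv|[-> ]]; last by rewrite ltn_add2l.
  apply: (@leq_trans ((level u).+1 * n.*2)); first by rewrite mulSnr ltn_add2l.
  by apply: leq_trans (leq_addr _ _); rewrite leq_mul2r lt_uv orbT.
have level_g w q : block g w = Some q -> level w = (h q).*2.+1.
  by rewrite block_swap /level => ->.
move=> gv; have [act_v|inact_v] := boolP (active g v).
  right; have /activeP[b [a [gv' gu lt_av lt_vu hop_v]]] := act_v.
  move: gv'; rewrite gv => -[eq_u]; rewrite -{}eq_u in gu lt_vu *.
  have lt_au := ltn_trans lt_av lt_vu; split.
    rewrite (level_g _ _ (block_active act_v)) (level_g _ _ (block_up gu lt_au)).
    by rewrite -hop_v block_root_hop.
  by rewrite /second gu gv lt_au (ltnNge u) (ltnW lt_vu) /=; lia.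
have [lt_uv|le_vu] := ltnP u v.
  have level_v := level_g _ _ (block_up gv lt_uv).
  have [act_u|inact_u] := boolP (active g u).
    right; split; first by rewrite level_v (level_g _ _ (block_active act_u)).
    have /activeP[b [a [gu _ _ lt_ub _]]] := act_u.
    by rewrite /second gv gu lt_uv (ltnNge b) (ltnW lt_ub) /=.
  (* Being inactive, [u] is its own block root: its level is at most [2 h u], just under the level
     [2 h u + 1] of [v]. *)
  left; rewrite level_v block_root_inactive //.
  rewrite active_swap in inact_u.
  rewrite /level /block (negPf inact_u); case fu: (f u) => [x|] //.
  by case: ifP => // _; have := h_root x; have := h_lt _ _ fu; lia.
left; have block_v : block f v = None.
  by rewrite -(block_swap _ s r) /block (negPf inact_v) gv ltnNge le_vu.
(* The parents of [v] before and after the swap are equal, or are two pending ends of block [r];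
   their levels agree in both cases. *)
have [w fv level_u] : exists2 w, f v = Some w & level u = level w.
  have [le_sv|lt_vs] := leqP s v.
    have vNP : v \notin pending f s r.
      by apply/negP=> /block_pending; rewrite block_v.
    by exists u => //; rewrite -gv /g /swap ffunE le_sv flip_notin.
  move: gv; rewrite /g /swap ffunE leqNgt lt_vs /=.
  case fv: (f v) => [w|//] [<-]; exists w => //.
  have [wP|wNP] := boolP (w \in pending f s r); last by rewrite flip_notin.
  rewrite /level (block_pending wP) (@block_pending f s r) //.
  by rewrite flip_mem.
rewrite level_u {2}/level block_v; have := level_le w.
by have := h_lt _ _ fv; lia.
Qed.

(** * Arc statistics at a vertex and their behaviour under a swap *)

Implicit Types R : rel 'I_n.

Definition stat R f c :=
  #|[set d : 'I_n | [&& active f c, c < d, f d == Some c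
               & oapp (R^~ d) false (f c)]]|.

Lemma stat_inactive R f c : ~~ active f c -> stat R f c = 0.
Proof.
by move=> inact_c; apply: eq_card0 => d; rewrite inE (negPf inact_c).
Qed.

Lemma stat_transport R R' f g c b b' (p : 'I_n -> 'I_n) :
    bijective p -> active f c -> active g c ->
    f c = Some b -> g c = Some b' ->
    (forall d : 'I_n, (c < p d) && (g (p d) == Some c) = (c < d) && (f d == Some c)) ->
    (forall d : 'I_n, c < d -> f d = Some c -> R' b' (p d) = R b d) ->
  stat R' g c = stat R f c.
Proof.
move=> bij_p act_f act_g fc gc child_p R_p.
rewrite /stat -(on_card_preimset (onW_bij _ bij_p)); apply: eq_card => d.
rewrite !inE act_f act_g fc gc /= andbA child_p andbA.
by apply: andb_id2l => /andP[lt_cd /eqP fd]; apply: R_p.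
Qed.

(** The parent of an active [c] and its children above [c] are all at least [s], and edges between
    such vertices do not change. *)
Lemma stat_swap_above R f s r (c : 'I_n) : s <= c -> stat R (swap f s r) c = stat R f c.
Proof.
move=> le_sc; have [act_c|inact_c] := boolP (active f c); last first.
  by rewrite !stat_inactive ?active_swap.
have fP := @straddle_pending f s r.
have /activeP[b [a [fc _ _ lt_cb _]]] := act_c.
apply: (@stat_transport R R f (swap f s r) c b b id) => //.
- by exists id.
- by rewrite active_swap.
- exact: exchange_above fP fc le_sc lt_cb.
move=> d; apply: andb_id2l => lt_cd; rewrite /swap ffunE.
rewrite (leq_trans le_sc (ltnW lt_cd)).
have [dP|dNP] := boolP (d \in pending f s r); last by rewrite flip_notin.
have not_c y : y \in pending f s r -> (f y == Some c) = false.
  by case/fP=> _ [x -> lt_xs]; apply/eqP=> -[eq_x]; rewrite eq_x in lt_xs; lia.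
by rewrite !not_c ?flip_mem.
Qed.

(** Every edge at [c] has an endpoint below [s], so parent and children are relabelled by the same
    flip. *)
Lemma stat_swap_below R R' f s r c b :
    active f c -> f c = Some b -> c < s ->
    (forall d : 'I_n, c < d -> f d = Some c ->
      R' (flip (pending f s r) b) (flip (pending f s r) d) = R b d) ->
  stat R' (swap f s r) c = stat R f c.
Proof.
move=> act_c fc lt_cs; have fP := @straddle_pending f s r.
apply: stat_transport => //.
- by exists (flip (pending f s r)); apply: flipK.
- by rewrite active_swap.
- exact: exchange_below fP fc lt_cs.
move=> d; rewrite /swap ffunE (straddle_leq_flip _ fP) flipK.
have [le_sd|lt_ds] := leqP s d.
  by rewrite !(leq_trans lt_cs) // (straddle_leq_flip _ fP).
rewrite (straddle_flip_lt fP lt_ds); congr (_ && _).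
case fd: (f d) => [x|] //=; apply/eqP/eqP=> [[]|[->]]; last first.
  by rewrite (straddle_flip_lt fP).
by move/(congr1 (flip (pending f s r)));
   rewrite flipK (straddle_flip_lt fP lt_cs) => ->.
Qed.

(** * Crossings, nestings and the transformation at one vertex *)

Definition crossing : rel 'I_n := fun b d => b < d.
Definition nesting : rel 'I_n := fun b d => d < b.

(* The first swap reverses all the pending arc ends at t.  The second one reverses
   again those with an opener smaller than t, so that in total these are moved
   in an order-preserving way and nothing changes at the vertices c < t. *)
Definition shift t f :=
  if active f t then
    swap (swap f t.+1 (block_root f t)) t (block_root f t)
  else f.

Lemma active_shift t f : active (shift t f) =1 active f.
Proof. by move=> x; rewrite /shift; case: ifP => //; rewrite !active_swap. Qed.

Lemma block_root_shift t f : block_root (shift t f) =1 block_root f.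
Proof. by move=> x; rewrite /shift; case: ifP => //; rewrite !block_root_swap. Qed.

(** Activity and block root of [t] can be read off the image, so the image determines which
    involutions were applied. *)
Lemma shift_inj t : injective (shift t).
Proof.
move=> f g eq_fg; have := active_shift t f t; have := block_root_shift t f t.
rewrite eq_fg active_shift block_root_shift => eq_root eq_act.
move: eq_fg; rewrite /shift -eq_act -eq_root; case: ifP => // _.
by move/(inv_inj (swapK t _))/(inv_inj (swapK t.+1 _)).
Qed.

Lemma forest_shift t f : is_forest f -> is_forest (shift t f).
Proof. by move=> ?; rewrite /shift; case: ifP => // _; do 2!apply: forest_swap. Qed.

(** Only the swap at [t.+1] affects the arcs at [t]. The parent of an active [t] and its children
    above [t] are all pending for it: their openers [a] and [t] share a block root. *)
Lemma stat_shift_eq R R' (t : 'I_n) f :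
    {in pending f t.+1 (block_root f t) &, forall b d,
       R' (flip (pending f t.+1 (block_root f t)) b)
          (flip (pending f t.+1 (block_root f t)) d) = R b d} ->
  stat R' (shift t f) t = stat R f t.
Proof.
move=> R_flip; have [act_t|inact_t] := boolP (active f t); last first.
  by rewrite !stat_inactive ?active_shift.
have /activeP[b [a [ft fb lt_at lt_tb hop_t]]] := act_t.
rewrite /shift act_t stat_swap_above //; apply: stat_swap_below ft _ _ => //.
move=> d lt_td fd; apply: R_flip; apply/pendingP; last by exists t.
by exists a; rewrite fb -hop_t block_root_hop hop_t (ltn_trans lt_at).
Qed.

(** Outside block [r] nothing moves. Inside it, ends beyond [t] are reversed twice and remain at
    least [t], and ends before [t] are fixed; [t] itself is no such end, because its parent is
    larger. *)
Lemma ltn_flip_flip (t : 'I_n) f q y z x x' :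
    let r := block_root f t in
    active f t ->
    f y = Some x -> x < t -> block_root f x = q ->
    f z = Some x' -> x' < t -> block_root f x' = q ->
  let p w := flip (pending (swap f t.+1 r) t r) (flip (pending f t.+1 r) w) in
  (p y < p z) = (y < z).
Proof.
move=> r act_t fy lt_xt root_x fz lt_x't root_x' p.
set P := pending f t.+1 r in p *; set Q := pending _ t r in p *.
have fP := @straddle_pending f t.+1 r; rewrite -/P in fP.
have gQ := @straddle_pending (swap f t.+1 r) t r; rewrite -/Q in gQ.
have flip_Q (w v : 'I_n) : f w = Some v -> v < t -> block_root f v = q ->
    (flip P w \in Q) = (t <= flip P w) && (q == r).
  move=> fw lt_vt root_v; rewrite inE [swap _ _ _ _](exchange_flip fP fw) //=.
    by rewrite lt_vt block_root_swap root_v.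
  exact: ltnW.
have ne_t (w v : 'I_n) : f w = Some v -> v < t -> w != t.
  move=> fw lt_vt; apply: contraTneq act_t => eq_w; apply/negP.
  case/activeP=> b [a [ft _ _ lt_tb _]]; move: ft; rewrite -eq_w fw => -[eq_v].
  by rewrite eq_v in lt_vt; lia.
have p_low (w : 'I_n) : w < t -> p w = w.
  move=> lt_wt; rewrite /p (straddle_flip_lt fP); last exact: ltnW.
  exact: straddle_flip_lt gQ lt_wt.
have [eq_qr|ne_qr] := eqVneq q r; last first.
  have p_id (w v : 'I_n) : f w = Some v -> v < t -> block_root f v = q -> p w = w.
    move=> fw lt_vt root_v; have wNP : w \notin P.
      apply/negP=> /pendingP[v' [fw' _ _ root_v']]; move: fw'.
      by rewrite fw => -[eq_v]; rewrite -root_v eq_v root_v' eqxx in ne_qr.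
    have := flip_Q _ _ fw lt_vt root_v; rewrite (negPf ne_qr) andbF /p.
    by rewrite (flip_notin wNP) => /negbT/flip_notin.
  by rewrite (p_id _ _ fy) ?(p_id _ _ fz).
have p_high (w v : 'I_n) : f w = Some v -> v < t -> block_root f v = q -> t < w ->
    [/\ w \in P, flip P w \in Q & t <= p w].
  move=> fw lt_vt root_v lt_tw; have wP : w \in P.
    by apply/pendingP; exists v; rewrite root_v; split=> //; apply: ltnW.
  have fwQ : flip P w \in Q.
    rewrite (flip_Q _ _ fw) // eq_qr eqxx andbT ltnW //.
    by rewrite (straddle_leq_flip _ fP).
  by split=> //; rewrite /p (straddle_leq_flip _ gQ); case: (gQ _ fwQ).
have := ne_t _ _ fy lt_xt; have := ne_t _ _ fz lt_x't.
rewrite -!val_eqE /= => ne_zt ne_yt.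
have [lt_ty|le_yt] := ltnP t y; have [lt_tz|le_zt] := ltnP t z.
- have [yP pyQ _] := p_high _ _ fy lt_xt root_x lt_ty.
  have [zP pzQ _] := p_high _ _ fz lt_x't root_x' lt_tz.
  by rewrite /p !ltn_flip.
- have [_ _ ?] := p_high _ _ fy lt_xt root_x lt_ty.
  by rewrite (p_low z); lia.
- have [_ _ ?] := p_high _ _ fz lt_x't root_x' lt_tz.
  by rewrite (p_low y); lia.
by rewrite !p_low //; lia.
Qed.

(** For [c > t] both swaps act trivially at [c]. For [c < t], the parent and the children of [c] are
    ends whose openers [a] and [c] are below [t] and in one block, so their relative order is
    kept. *)
Lemma stat_shift_neq R (t : 'I_n) f c : R = crossing \/ R = nesting -> c != t ->
  stat R (shift t f) c = stat R f c.
Proof.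
move=> R_eq ne_ct; rewrite /shift; case: ifP => // act_t.
have [act_c|inact_c] := boolP (active f c); last first.
  by rewrite !stat_inactive ?active_swap.
have [lt_tc|le_ct] := ltnP t c.
  by rewrite !stat_swap_above //; apply: ltnW.
have {le_ct}lt_ct : c < t by rewrite ltn_neqAle ne_ct.
have /activeP[b [a [fc fb lt_ac lt_cb hop_c]]] := act_c.
set r := block_root f t; set g := swap f t.+1 r.
have gc : g c = Some (flip (pending f t.+1 r) b).
  by apply: exchange_below fc _; [apply: straddle_pending | apply: ltnW].
have act_gc : active g c by rewrite active_swap.
(* [R] pulled back along the second flip, so that the two swaps are undone one after the other. *)
pose R1 x y := R (flip (pending g t r) x) (flip (pending g t r) y).
rewrite (@stat_swap_below R1 R g t r c _ act_gc gc lt_ct) //.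
apply: (stat_swap_below act_c fc (ltnW lt_ct : c < t.+1)) => d lt_cd fd.
have root_a : block_root f a = block_root f c by rewrite -hop_c block_root_hop.
rewrite /R1; case: R_eq => ->; rewrite /crossing /nesting.
  exact: (ltn_flip_flip act_t fb (ltn_trans lt_ac lt_ct) root_a fd).
exact: (ltn_flip_flip act_t fd lt_ct (erefl _) fb (ltn_trans lt_ac lt_ct)).
Qed.

(** * Interpolation between crossings and nestings *)

Definition hybrid (t : nat) f :=
  \sum_(c < n) stat (if c < t then nesting else crossing) f c.

Lemma hybrid_shift (t : 'I_n) f :
  hybrid t.+1 (shift t f) = hybrid t f /\ hybrid t (shift t f) = hybrid t.+1 f.
Proof.
split; apply: eq_bigr => c _; have [->|ne_ct] := eqVneq c t.
- rewrite ltnSn ltnn; apply: stat_shift_eq => b d bP dP.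
  by rewrite /nesting ltn_flip.
- rewrite (_ : (c < t.+1) = (c < t)); last by rewrite [RHS]ltn_neqAle ne_ct ltnS.
  by apply: stat_shift_neq => //; case: ifP; [right|left].
- rewrite ltnSn ltnn; apply: stat_shift_eq => b d bP dP.
  by rewrite /crossing ltn_flip.
rewrite (_ : (c < t.+1) = (c < t)); last by rewrite [RHS]ltn_neqAle ne_ct ltnS.
by apply: stat_shift_neq => //; case: ifP; [right|left].
Qed.

(** [shift] at [t] interchanges the values of [hybrid t] and [hybrid t.+1], so it injects each level
    set into the other. *)
Lemma card_hybrid t m : t <= n ->
  #|[set f in forests n | hybrid t f == m]| =
  #|[set f in forests n | hybrid 0 f == m]|.
Proof.
elim: t => // t IHt lt_tn; rewrite -IHt; last exact: ltnW.
pose t' := Ordinal lt_tn.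
by apply/eqP; rewrite eqn_leq; apply/andP; split;
  rewrite -(card_imset _ (@shift_inj t')); apply/subset_leq_card/subsetP;
  move=> _ /imsetP[f + ->]; rewrite !inE => /andP[/forest_shift -> /eqP <-];
  have [hyb hyb'] := hybrid_shift t' f; apply/eqP.
Qed.

Lemma card_instances R f :
  #|[set d : 'I_n | oapp (fun c : 'I_n =>
       [&& active f c, c < d & oapp (R^~ d) false (f c)]) false (f d)]| =
  \sum_c stat R f c.
Proof.
rewrite -sum1_card; under [RHS]eq_bigr do rewrite /stat -sum1_card.
rewrite (exchange_big_dep xpredT) //= big_mkcond.
apply: eq_bigr => d _; rewrite inE; case fd: (f d) => [c|] /=.
  rewrite big_mkcond (bigD1 c) //= inE fd eqxx /= big1 ?addn0 //.
  move=> i ne_ic; rewrite inE fd; case: ifP => // /and4P[_ _ /eqP[]] /eqP.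
  by rewrite eq_sym (negPf ne_ic).
by rewrite big_pred0 // => c; rewrite inE fd /= !andbF.
Qed.

End Exchange.

(** * Instances of the two patterns as crossings and nestings *)

Lemma pattern1324E (i : 'I_4) : pattern1324 i = nth 0 [:: 0; 2; 1; 3] i :> nat.
Proof.
apply: succn_inj; rewrite one_lineE (tnth_nth 0) /=.
by case: i => -[|[|[|[]]]].
Qed.

Lemma pattern1423E (i : 'I_4) : pattern1423 i = nth 0 [:: 0; 3; 1; 2] i :> nat.
Proof.
apply: succn_inj; rewrite one_lineE (tnth_nth 0) /=.
by case: i => -[|[|[|[]]]].
Qed.

Lemma forall_I4 (p : pred 'I_4) :
  [forall i, p i] = [&& p (@Ordinal 4 0 isT), p (@Ordinal 4 1 isT),
                        p (@Ordinal 4 2 isT) & p (@Ordinal 4 3 isT)].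
Proof.
apply/forallP/and4P => [p_all|[p0 p1 p2 p3] [[|[|[|[|//]]]] lt_i4]].
  by split; apply: p_all.
all: by rewrite (bool_irrelevance lt_i4 isT).
Qed.

Lemma instance1324 n (f : {ffun 'I_n -> option 'I_n}) a b c d :
  consecutive_instance f pattern1324 [tuple a; b; c; d] =
  [&& f b == Some a, f c == Some b, f d == Some c, a < c, c < b & b < d].
Proof.
rewrite /consecutive_instance !forall_I4 !pattern1324E !(tnth_nth a) /=.
rewrite /is_parent !andbT !ltnn /=.
case: (f b == _) (f c == _) (f d == _) => [] [] [] //=; lia.
Qed.

Lemma instance1423 n (f : {ffun 'I_n -> option 'I_n}) a b c d :
  consecutive_instance f pattern1423 [tuple a; b; c; d] =
  [&& f b == Some a, f c == Some b, f d == Some c, a < c, c < d & d < b].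
Proof.
rewrite /consecutive_instance !forall_I4 !pattern1423E !(tnth_nth a) /=.
rewrite /is_parent !andbT !ltnn /=.
case: (f b == _) (f c == _) (f d == _) => [] [] [] //=; lia.
Qed.

(** Parents are unique, so the last vertex [d] determines the whole instance; it remains to count
    the possible [d]. *)
Lemma num_instances_stat n (f : {ffun 'I_n -> option 'I_n}) (sigma : 'S_4) R :
    (forall a b c d, consecutive_instance f sigma [tuple a; b; c; d] =
      [&& f b == Some a, f c == Some b, f d == Some c,
          a < c, c < b, c < d & R b d]) ->
  num_instances f sigma = \sum_c stat R f c.
Proof.
move=> instE; rewrite -card_instances /num_instances.
have tuple4 (v : 4.-tuple 'I_n) : exists a b c d, v = [tuple a; b; c; d].
  case: v => -[|a [|b [|c [|d []]]]] //= size_v.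
  by exists a, b, c, d; apply: val_inj.
rewrite -(@card_in_imset _ _ (fun v => tnth v (@Ordinal 4 3 isT))); last first.
  move=> v v'; have [a [b [c [d ->]]]] := tuple4 v.
  have [a' [b' [c' [d' ->]]]] := tuple4 v'.
  rewrite !inE !instE !(tnth_nth a) /= => /and4P[/eqP fb /eqP fc /eqP fd _].
  move=> /and4P[/eqP fb' /eqP fc' /eqP fd' _] eq_d; subst d'.
  move: fd' fc' fb'; rewrite fd => -[<-]; rewrite fc => -[<-].
  by rewrite fb => -[<-].
apply: eq_card => d; rewrite [in RHS]inE; apply/imsetP/idP => [[v]|].
  have [a [b [c [d' ->]]]] := tuple4 v; rewrite inE instE (tnth_nth a) /=.
  case/and5P=> /eqP fb /eqP fc /eqP fd lt_ac /and3P[lt_cb lt_cd R_bd] ->.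
  by rewrite fd /= (active_intro fc fb) // lt_cd fc.
case fd: (f d) => [c|] //= /and3P[/activeP[b [a [fc fb lt_ac lt_cb _]]] lt_cd].
rewrite fc /= => R_bd; exists [tuple a; b; c; d]; last by rewrite (tnth_nth a).
by rewrite inE instE fb fc fd !eqxx lt_ac lt_cb lt_cd.
Qed.

(** * Equidistribution of instances, and avoidance as a special case *)

Theorem theorem1p6 :
  strong_c_forest_Wilf_equivalent pattern1324 pattern1423 /\
  c_forest_Wilf_equivalent pattern1324 pattern1423.
Proof.
have strong : strong_c_forest_Wilf_equivalent pattern1324 pattern1423.
  move=> n m.
  (* No vertex is below [0] and all are below [n], so at these two ends [hybrid] counts only
     crossings, respectively only nestings. *)
  have num1324 (f : {ffun 'I_n -> option 'I_n}) : num_instances f pattern1324 = hybrid 0 f.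
    apply: num_instances_stat => a b c d; rewrite instance1324 /crossing.
    by do 4!congr (_ && _); lia.
  have num1423 (f : {ffun 'I_n -> option 'I_n}) : num_instances f pattern1423 = hybrid n f.
    transitivity (\sum_c stat (@nesting n) f c); last first.
      by apply: eq_bigr => c _; rewrite ltn_ord.
    apply: num_instances_stat => a b c d; rewrite instance1423 /nesting.
    by do 4!congr (_ && _); lia.
  under eq_finset do rewrite num1324; under [in RHS]eq_finset do rewrite num1423.
  by rewrite (card_hybrid m (leqnn n)).
split=> // n.
(* Avoidance is the case [m = 0] of the strong equivalence. *)
have avoidsE k (sigma : 'S_k) (f : {ffun 'I_n -> option 'I_n}) :
    avoids f sigma = (num_instances f sigma == 0).
  rewrite /avoids /num_instances cards_eq0 negb_exists.
  apply/forallP/eqP => [no_v|/setP no_v v].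
    by apply/setP=> v; rewrite !inE (negPf (no_v v)).
  by have := no_v v; rewrite !inE => ->.
under eq_finset do rewrite avoidsE; under [in RHS]eq_finset do rewrite avoidsE.
exact: strong.
Qed.
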